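(* Let $\mathcal{C}$ be any of temporalisation $\mathcal{L}$, probabilisation $\mathcal{P}$ or hybridisation $\mathcal{H}$. If $(\Phi,\alpha,\beta):\mathcal{I}\to\mathcal{I}'$ is a conservative comorphism, then the lifted comorphism $\mathcal{C}(\Phi,\alpha,\beta):\mathcal{C}\mathcal{I}\to\mathcal{C}\mathcal{I}'$ is conservative.
   Context: Institutions $\mathcal{I}=(Sign^{\mathcal{I}},Sen^{\mathcal{I}},Mod^{\mathcal{I}},\models)$ and comorphisms $(\Phi,\alpha,\beta)$ (functor $\Phi$ on signatures, natural $\alpha:Sen^{\mathcal{I}}\Rightarrow Sen^{\mathcal{I}'}\circ\Phi$, natural $\beta:Mod^{\mathcal{I}'}\circ\Phi^{op}\Rightarrow Mod^{\mathcal{I}}$, with $\beta_\Sigma(M)\models\rho$ iff $M\models\alpha_\Sigma(\rho)$) are as usual. A comorphism is conservative if every $\beta_\Sigma$ is surjective on objects. For each $\mathcal{C}\in\{\mathcal{L},\mathcal{P},\mathcal{H}\}$, the signatures of $\mathcal{C}\mathcal{I}$ are pairs $(\Delta,\Sigma)$ with $\Sigma$ an $\mathcal{I}$-signature and $\Delta$ a top-level signature (only one for $\mathcal{L},\mathcal{P}$; a pair $(Nom,\Lambda)$ of sets of nominals and modalities for $\mathcal{H}$), and $Mod^{\mathcal{C}\mathcal{I}}(\Delta,\Sigma)$ is a discrete category whose objects are all triples $(S,R,m)$ with $R$ a top-level structure on the set $S$ and $m:S\to|Mod^{\mathcal{I}}(\Sigma)|$ an arbitrary function: for $\mathcal{L}$,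 $S=\mathbb{N}$ and $R$ is the successor function; for $\mathcal{P}$, $R=p:2^S\to[0,1]$ a probability measure; for $\mathcal{H}$, $R=((R_i)_{i\in Nom},(R_\lambda)_{\lambda\in\Lambda})$ with $R_i\in S$, $R_\lambda\subseteq S\times S$. Sentences of $\mathcal{C}\mathcal{I}$ are: for $\mathcal{L}$, $\rho::=\psi\mid\neg\rho\mid\rho\wedge\rho\mid X\rho\mid\rho U\rho$; for $\mathcal{P}$, $\rho::=t<t\mid\neg\rho\mid\rho\wedge\rho$ with terms $t::=r\mid\int\psi\mid t+t\mid t.t$ ($r\in\mathbb{R}$); for $\mathcal{H}$, $\rho::=i\mid\psi\mid\neg\rho\mid\rho\wedge\rho\mid@_i\rho\mid\langle\lambda\rangle\rho$; always $\psi\in Sen^{\mathcal{I}}(\Sigma)$. Satisfaction: for $\mathcal{L}$, $M\models\rho$ iff $M\models^0\rho$ with $M\models^j\psi$ iff $m(j)\models\psi$, $M\models^jX\rho$ iff $M\models^{j+1}\rho$, $M\models^j\rho U\rho'$ iff some $k\ge j$ has $M\models^k\rho'$ and $M\models^i\rho$ for $j\le i<k$; for $\mathcal{P}$, $M\models t<t'$ iff $M_t<M_{t'}$ where $M_r=r$, $M_{\int\psi}=p(\{s:m(s)\models\psi\})$, $+$ and $.$ interpreted as real addition and multiplication; for $\mathcal{H}$, $M\models\rho$ iff $M\models^w\rho$ for all $w\in S$, where $M\models^wi$ iff $R_i=w$, $M\models^w\psi$ iff $m(w)\models\psi$, $M\models^w@_i\rho$ iff $M\models^{R_i}\rho$,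 $M\models^w\langle\lambda\rangle\rho$ iff $M\models^{w'}\rho$ for some $w'$ with $(w,w')\in R_\lambda$; Boolean connectives as usual in all cases. The lifted comorphism $\mathcal{C}(\Phi,\alpha,\beta)=(\mathcal{C}\Phi,\mathcal{C}\alpha,\mathcal{C}\beta)$ is given by $\mathcal{C}\Phi(\Delta,\Sigma)=(\Delta,\Phi(\Sigma))$ (identity on the top component), $(\mathcal{C}\alpha)_{(\Delta,\Sigma)}(\rho)=\rho$ with every base sentence $\psi$ replaced by $\alpha_\Sigma(\psi)$, and $(\mathcal{C}\beta)_{(\Delta,\Sigma)}(S,R,m)=(S,R,\beta_\Sigma\circ m)$. *)

(* Defs.v *)
From HB Require Import structures.
From mathcomp Require Import all_boot all_order all_algebra.
From mathcomp Require Import boolp classical_sets reals ereal measure.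

Set Implicit Arguments.
Unset Strict Implicit.
Unset Printing Implicit Defensive.

Import Order.TTheory GRing.Theory Num.Theory.

Local Open Scope classical_set_scope.

Record category := Category {
  obj :> Type;
  hom : obj -> obj -> Type;
  idm : forall a, hom a a;
  comp : forall a b c, hom b c -> hom a b -> hom a c;
  comp_idl : forall a b (f : hom a b), comp (idm b) f = f;
  comp_idr : forall a b (f : hom a b), comp f (idm a) = f;
  comp_assoc : forall a b c d (h : hom c d) (g : hom b c) (f : hom a b),
    comp h (comp g f) = comp (comp h g) f }.
Arguments idm {_} _.

Record functor (C D : category) := Functor {
  fobj :> C -> D;
  fmap : forall a b, hom a b -> hom (fobj a) (fobj b);
  fmap_id : forall a, fmap (idm a) = idm (fobj a);
  fmap_comp : forall a b c (g : hom b c) (f : hom a b),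
    fmap (comp g f) = comp (fmap g) (fmap f) }.

Definition id_functor (C : category) : functor C C :=
  @Functor C C id (fun _ _ f => f) (fun _ => erefl) (fun _ _ _ _ _ => erefl).

Section CompFunctor.
Variables (C D E : category) (G : functor D E) (F : functor C D).

Let gf_map a b (f : hom a b) := fmap G (fmap F f).

Let gf_id a : gf_map (idm a) = idm (G (F a)).
Proof. by rewrite /gf_map !fmap_id. Qed.

Let gf_comp a b c (g : hom b c) (f : hom a b) :
  gf_map (comp g f) = comp (gf_map g) (gf_map f).
Proof. by rewrite /gf_map !fmap_comp. Qed.

Definition comp_functor : functor C E :=
  @Functor C E (fun a => G (F a)) gf_map gf_id gf_comp.

End CompFunctor.

Section ProdCategory.
Variables (C D : category).

Let phom (x y : C * D) : Type := (hom x.1 y.1 * hom x.2 y.2)%type.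
Let pid (x : C * D) : phom x x := (idm x.1, idm x.2).
Let pcomp x y z (g : phom y z) (f : phom x y) : phom x z :=
  (comp g.1 f.1, comp g.2 f.2).

Let pcomp_idl x y (f : phom x y) : pcomp (pid y) f = f.
Proof. by case: f => f1 f2; rewrite /pcomp /= !comp_idl. Qed.

Let pcomp_idr x y (f : phom x y) : pcomp f (pid x) = f.
Proof. by case: f => f1 f2; rewrite /pcomp /= !comp_idr. Qed.

Let pcomp_assoc x y z t (h : phom z t) (g : phom y z) (f : phom x y) :
  pcomp h (pcomp g f) = pcomp (pcomp h g) f.
Proof. by rewrite /pcomp /= !comp_assoc. Qed.

Definition prod_category : category :=
  @Category (C * D)%type phom pid pcomp pcomp_idl pcomp_idr pcomp_assoc.

End ProdCategory.

Section Discrete.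
Variable A : Type.

Let dcomp (x y z : A) (g : y = z) (f : x = y) : x = z := etrans f g.

Let dcomp_idl (x y : A) (f : x = y) : dcomp erefl f = f.
Proof. exact: Prop_irrelevance. Qed.

Let dcomp_idr (x y : A) (f : x = y) : dcomp f erefl = f.
Proof. exact: Prop_irrelevance. Qed.

Let dcomp_assoc (x y z t : A) (h : z = t) (g : y = z) (f : x = y) :
  dcomp h (dcomp g f) = dcomp (dcomp h g) f.
Proof. exact: Prop_irrelevance. Qed.

Definition discrete : category :=
  @Category A (fun x y => x = y) (fun x => erefl x) dcomp
    dcomp_idl dcomp_idr dcomp_assoc.

End Discrete.

Section DiscreteFunctor.
Variables (A B : Type) (f : A -> B).

Definition discrete_functor : functor (discrete A) (discrete B) :=
  @Functor (discrete A) (discrete B) f (fun x y (e : x = y) => congr1 f e)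
    (fun x => erefl)
    (fun x y z _ _ => @Prop_irrelevance (f x = f z) _ _).

End DiscreteFunctor.

Lemma eq_discrete_functor (C : category) (A : Type)
  (F G : functor C (discrete A)) : (forall x, F x = G x) -> F = G.
Proof.
case: F G => [F Fm Fi Fc] [G Gm Gi Gc] /= FG.
have {}FG : F = G by apply: boolp.functional_extensionality_dep.
case: G / FG Gm Gi Gc => Gm Gi Gc.
have mE : Fm = Gm.
  do 3 (apply: boolp.functional_extensionality_dep => ?).
  exact: (@Prop_irrelevance (_ = _)).
by case: Gm / mE Gi Gc => Gi Gc; f_equal; exact: Prop_irrelevance.
Qed.

(* [Sen] with [sen_map] is the functor Sign -> Set and [Mod] with [mod_map]
   the functor Sign^op -> Cat, with functoriality written out. *)
Record institution := Institution {
  Sign : category;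
  Sen : Sign -> Type;
  sen_map : forall a b : Sign, hom a b -> Sen a -> Sen b;
  sen_map_id : forall (a : Sign) (x : Sen a), sen_map (idm a) x = x;
  sen_map_comp : forall (a b c : Sign) (g : hom b c) (f : hom a b) (x : Sen a),
    sen_map (comp g f) x = sen_map g (sen_map f x);
  Mod : Sign -> category;
  mod_map : forall a b : Sign, hom a b -> functor (Mod b) (Mod a);
  mod_map_id : forall a : Sign, mod_map (idm a) = id_functor (Mod a);
  mod_map_comp : forall (a b c : Sign) (g : hom b c) (f : hom a b),
    mod_map (comp g f) = comp_functor (mod_map f) (mod_map g);
  sat : forall a : Sign, Mod a -> Sen a -> Prop;
  sat_map : forall (a b : Sign) (f : hom a b) (M : Mod b) (x : Sen a),
    sat (mod_map f M) x <-> sat M (sen_map f x) }.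

Arguments Sen {i}.
Arguments Mod {i}.
Arguments sat {i a}.

Record comorphism (I J : institution) := Comorphism {
  Phi : functor (Sign I) (Sign J);
  alpha : forall a : Sign I, Sen a -> Sen (Phi a);
  alpha_nat : forall (a b : Sign I) (f : hom a b) (x : Sen a),
    alpha (sen_map f x) = sen_map (fmap Phi f) (alpha x);
  beta : forall a : Sign I, functor (Mod (Phi a)) (Mod a);
  beta_nat : forall (a b : Sign I) (f : hom a b),
    comp_functor (mod_map f) (beta b) =
    comp_functor (beta a) (mod_map (fmap Phi f));
  comorphism_sat : forall (a : Sign I) (M : Mod (Phi a)) (x : Sen a),
    sat (beta a M) x <-> sat M (alpha x) }.

Arguments alpha {I J} c {a}.

Definition conservative (I J : institution) (f : comorphism I J) : Prop :=
  forall (a : Sign I) (M : Mod a), exists N : Mod (Phi f a), beta f a N = M.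

(* The common shape of temporalisation, probabilisation and hybridisation:
   [tstr D S] are the top-level structures over the top-level signature [D] on
   the set [S], [tsen D A] the sentences over [D] with base sentences in [A],
   and [tsat R v] satisfaction in [R] when [v s psi] says that the base model
   attached to [s] satisfies the base sentence [psi]. *)
Record top_layer := TopLayer {
  tsign : category;
  tstr : tsign -> Type -> Type;
  tstr_map : forall (D E : tsign) (S : Type), hom D E -> tstr E S -> tstr D S;
  tstr_map_id : forall (D : tsign) (S : Type) (r : tstr D S),
    tstr_map (idm D) r = r;
  tstr_map_comp : forall (D E F : tsign) (S : Type) (g : hom E F) (f : hom D E)
    (r : tstr F S), tstr_map (comp g f) r = tstr_map f (tstr_map g r);
  tsen : tsign -> Type -> Type;
  tsen_map : forall (D E : tsign) (A B : Type),
    hom D E -> (A -> B) -> tsen D A -> tsen E B;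
  tsen_map_id : forall (D : tsign) (A : Type) (x : tsen D A),
    tsen_map (idm D) id x = x;
  tsen_map_comp : forall (D E F : tsign) (A B C : Type)
    (d' : hom E F) (d : hom D E) (g : B -> C) (f : A -> B) (x : tsen D A),
    tsen_map (comp d' d) (fun a => g (f a)) x = tsen_map d' g (tsen_map d f x);
  tsat : forall (D : tsign) (S A : Type),
    tstr D S -> (S -> A -> Prop) -> tsen D A -> Prop;
  tsat_map : forall (D E : tsign) (S A B : Type) (d : hom D E) (r : tstr E S)
    (f : A -> B) (v : S -> B -> Prop) (x : tsen D A),
    tsat (tstr_map d r) (fun s a => v s (f a)) x <->
    tsat r v (tsen_map d f x) }.

Section LiftInstitution.
Variables (K : top_layer) (I : institution).

Definition lift_sign : category := prod_category (tsign K) (Sign I).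

Definition lift_sen (x : lift_sign) : Type := tsen x.1 (Sen x.2).

Definition lift_sen_map (x y : lift_sign) (f : hom x y) :
  lift_sen x -> lift_sen y := tsen_map f.1 (sen_map f.2).

Record lift_model (x : lift_sign) := LiftModel {
  carrier : Type;
  structure : tstr x.1 carrier;
  label : carrier -> Mod x.2 }.
Arguments label {x}.

Definition lift_reduct (x y : lift_sign) (f : hom x y) (M : lift_model y) :
  lift_model x :=
  LiftModel (tstr_map f.1 (structure M)) (fun s => mod_map f.2 (label M s)).

Definition lift_sat (x : lift_sign) (M : lift_model x) (r : lift_sen x) : Prop :=
  tsat (structure M) (fun s psi => sat (label M s) psi) r.

Let lift_sen_map_id (x : lift_sign) (r : lift_sen x) :
  lift_sen_map (idm x) r = r.
Proof.
rewrite /lift_sen_map /= -[RHS]tsen_map_id; congr tsen_map.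
apply: boolp.functional_extensionality_dep => a; exact: sen_map_id.
Qed.

Let lift_sen_map_comp (x y z : lift_sign) (g : hom y z) (f : hom x y)
    (r : lift_sen x) :
  lift_sen_map (comp g f) r = lift_sen_map g (lift_sen_map f r).
Proof.
rewrite /lift_sen_map /= -tsen_map_comp; congr tsen_map.
apply: boolp.functional_extensionality_dep => a; exact: sen_map_comp.
Qed.

Let lift_mod (x : lift_sign) : category := discrete (lift_model x).

Let lift_mod_map (x y : lift_sign) (f : hom x y) :
  functor (lift_mod y) (lift_mod x) := discrete_functor (lift_reduct f).

Let lift_mod_map_id (x : lift_sign) :
  lift_mod_map (idm x) = id_functor (lift_mod x).
Proof.
apply: eq_discrete_functor => -[S r m] /=; rewrite /lift_reduct /=.
rewrite tstr_map_id; congr LiftModel.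
by apply: boolp.functional_extensionality_dep => s; rewrite mod_map_id.
Qed.

Let lift_mod_map_comp (x y z : lift_sign) (g : hom y z) (f : hom x y) :
  lift_mod_map (comp g f) = comp_functor (lift_mod_map f) (lift_mod_map g).
Proof.
apply: eq_discrete_functor => -[S r m] /=; rewrite /lift_reduct /=.
rewrite tstr_map_comp; congr LiftModel.
by apply: boolp.functional_extensionality_dep => s; rewrite mod_map_comp.
Qed.

Let lift_sat_map (x y : lift_sign) (f : hom x y) (M : lift_model y)
    (r : lift_sen x) :
  lift_sat (lift_reduct f M) r <-> lift_sat M (lift_sen_map f r).
Proof.
rewrite /lift_sat /lift_sen_map /= -tsat_map.
have -> // : (fun s psi => sat (mod_map f.2 (label M s)) psi) =
             (fun s psi => sat (label M s) (sen_map f.2 psi)).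
do 2 (apply: boolp.functional_extensionality_dep => ?).
by apply: propext; exact: sat_map.
Qed.

Definition lift : institution :=
  @Institution lift_sign lift_sen lift_sen_map lift_sen_map_id lift_sen_map_comp
    lift_mod lift_mod_map lift_mod_map_id lift_mod_map_comp lift_sat
    lift_sat_map.

End LiftInstitution.

Arguments label {K I x}.

Section LiftComorphism.
Variables (K : top_layer) (I J : institution) (f : comorphism I J).

Let lift_Phi_map (x y : lift_sign K I) (g : hom x y) :
  @hom (lift_sign K J) (x.1, Phi f x.2) (y.1, Phi f y.2) :=
  (g.1, fmap (Phi f) g.2).

Let lift_Phi_id (x : lift_sign K I) :
  lift_Phi_map (idm x) = @idm (lift_sign K J) (x.1, Phi f x.2).
Proof. by rewrite /lift_Phi_map /= fmap_id. Qed.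

Let lift_Phi_comp (x y z : lift_sign K I) (h : hom y z) (g : hom x y) :
  lift_Phi_map (comp h g) =
  @comp (lift_sign K J) _ _ _ (lift_Phi_map h) (lift_Phi_map g).
Proof. by rewrite /lift_Phi_map /= fmap_comp. Qed.

Definition lift_Phi : functor (lift_sign K I) (lift_sign K J) :=
  @Functor (lift_sign K I) (lift_sign K J) (fun x => (x.1, Phi f x.2))
    lift_Phi_map lift_Phi_id lift_Phi_comp.

Definition lift_alpha (x : lift_sign K I) :
  @Sen (lift K I) x -> @Sen (lift K J) (lift_Phi x) :=
  tsen_map (idm x.1) (@alpha _ _ f x.2).

Definition lift_beta (x : lift_sign K I) :
  functor (@Mod (lift K J) (lift_Phi x)) (@Mod (lift K I) x) :=
  discrete_functor (fun M : lift_model (lift_Phi x) =>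
    @LiftModel K I x (carrier M) (structure M)
      (fun s => beta f x.2 (label M s))).

Let lift_alpha_nat (x y : lift_sign K I) (g : hom x y)
    (r : @Sen (lift K I) x) :
  lift_alpha (@sen_map (lift K I) _ _ g r) =
  @sen_map (lift K J) _ _ (fmap lift_Phi g) (lift_alpha r).
Proof.
rewrite /lift_alpha /= /lift_sen_map /= -!tsen_map_comp comp_idl comp_idr.
congr tsen_map.
apply: boolp.functional_extensionality_dep => a; exact: alpha_nat.
Qed.

Let lift_beta_nat (x y : lift_sign K I) (g : hom x y) :
  comp_functor (@mod_map (lift K I) _ _ g) (lift_beta y) =
  comp_functor (lift_beta x) (@mod_map (lift K J) _ _ (fmap lift_Phi g)).
Proof.
apply: eq_discrete_functor => -[S r m] /=; rewrite /lift_reduct /=.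
congr LiftModel; apply: boolp.functional_extensionality_dep => s.
exact: (congr1 (fun F => fobj F (m s)) (beta_nat f g.2)).
Qed.

Let lift_comorphism_sat (x : lift_sign K I)
    (M : @Mod (lift K J) (lift_Phi x)) (r : @Sen (lift K I) x) :
  @sat (lift K I) _ (lift_beta x M) r <-> @sat (lift K J) _ M (lift_alpha r).
Proof.
rewrite /= /lift_sat /lift_alpha /= -tsat_map tstr_map_id.
have -> // : (fun s psi => sat (beta f x.2 (label M s)) psi) =
             (fun s psi => sat (label M s) (alpha f psi)).
do 2 (apply: boolp.functional_extensionality_dep => ?).
by apply: propext; exact: comorphism_sat.
Qed.

Definition lift_comorphism : comorphism (lift K I) (lift K J) :=
  @Comorphism (lift K I) (lift K J) lift_Phi lift_alpha lift_alpha_nat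
    lift_beta lift_beta_nat lift_comorphism_sat.

End LiftComorphism.

Definition one_category : category := discrete unit.

Section Temporal.

Inductive lsen (A : Type) : Type :=
| LBase of A
| LNot of lsen A
| LAnd of lsen A & lsen A
| LNext of lsen A
| LUntil of lsen A & lsen A.

Fixpoint lsen_map (A B : Type) (f : A -> B) (x : lsen A) : lsen B :=
  match x with
  | LBase a => LBase (f a)
  | LNot x => LNot (lsen_map f x)
  | LAnd x y => LAnd (lsen_map f x) (lsen_map f y)
  | LNext x => LNext (lsen_map f x)
  | LUntil x y => LUntil (lsen_map f x) (lsen_map f y)
  end.

Fixpoint lsat_at (A : Type) (v : nat -> A -> Prop) (j : nat) (x : lsen A) :
  Prop :=
  match x with
  | LBase a => v j a
  | LNot x => ~ lsat_at v j x
  | LAnd x y => lsat_at v j x /\ lsat_at v j y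
  | LNext x => lsat_at v j.+1 x
  | LUntil x y => exists k, [/\ (j <= k)%N, lsat_at v k y &
      forall i, (j <= i < k)%N -> lsat_at v i x]
  end.

(* The only temporal structure is the set of natural numbers with successor. *)
Variant nat_succ : Type -> Type := NatSucc : nat_succ nat.

Definition lsat (S A : Type) (r : nat_succ S) :
  (S -> A -> Prop) -> lsen A -> Prop :=
  match r in nat_succ S return (S -> A -> Prop) -> lsen A -> Prop with
  | NatSucc => fun v => lsat_at v 0
  end.

Let lsen_map_id (A : Type) (x : lsen A) : lsen_map id x = x.
Proof. by elim: x => //= [x ->|x -> y ->|x ->|x -> y ->]. Qed.

Let lsen_map_comp (A B C : Type) (g : B -> C) (f : A -> B) (x : lsen A) :
  lsen_map (fun a => g (f a)) x = lsen_map g (lsen_map f x).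
Proof. by elim: x => //= [x ->|x -> y ->|x ->|x -> y ->]. Qed.

Let lsat_map (S A B : Type) (r : nat_succ S) (f : A -> B)
    (v : S -> B -> Prop) (x : lsen A) :
  lsat r (fun s a => v s (f a)) x <-> lsat r v (lsen_map f x).
Proof.
case: r v => v /=.
suff satE j : lsat_at (fun s a => v s (f a)) j x = lsat_at v j (lsen_map f x).
  by rewrite satE.
elim: x j => /= [a|x IH|x IHx y IHy|x IH|x IHx y IHy] j.
- by [].
- by rewrite IH.
- by rewrite IHx IHy.
- exact: IH.
- apply: propext; split=> -[k [jk yk xi]]; exists k; split=> //.
  + by rewrite -IHy.
  + by move=> i /xi; rewrite IHx.
  + by rewrite IHy.
  + by move=> i /xi; rewrite IHx.
Qed.

Definition temporal_layer : top_layer :=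
  @TopLayer one_category (fun _ => nat_succ) (fun _ _ _ _ r => r)
    (fun _ _ _ => erefl) (fun _ _ _ _ _ _ _ => erefl)
    (fun _ => lsen) (fun _ _ A B _ f => lsen_map f)
    (fun _ => lsen_map_id) (fun _ _ _ A B C _ _ => @lsen_map_comp A B C)
    (fun _ => lsat) (fun _ _ S A B _ => @lsat_map S A B).

End Temporal.

(* [S] with its powerset sigma-algebra; a [measurableType] must be pointed. *)
Definition powerset_space (S : Type) (s0 : S) : Type := S.

Section PowersetSpace.
Variables (S : Type) (s0 : S).
HB.instance Definition _ := gen_eqMixin (powerset_space s0).
HB.instance Definition _ := gen_choiceMixin (powerset_space s0).
HB.instance Definition _ := isPointed.Build (powerset_space s0) s0.
HB.instance Definition _ := @isMeasurable.Build default_measure_display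
  (powerset_space s0) discrete_measurable discrete_measurable0
  discrete_measurableC discrete_measurableU.
End PowersetSpace.

Section Probabilistic.
Variable R : realType.

(* The point is quantified away, so that the structure on [S] is just [p]. *)
Record powerset_probability (S : Type) := PowersetProbability {
  prob :> set S -> R;
  probP : exists (s0 : S) (P : probability (powerset_space s0) R),
    forall X : set S, P X = (prob X)%:E }.

Inductive pterm (A : Type) : Type :=
| PConst of R
| PInt of A
| PAdd of pterm A & pterm A
| PMul of pterm A & pterm A.

Inductive psen (A : Type) : Type :=
| PLt of pterm A & pterm A
| PNot of psen A
| PAnd of psen A & psen A.

Fixpoint pterm_map (A B : Type) (f : A -> B) (t : pterm A) : pterm B :=
  match t with
  | PConst r => PConst B r
  | PInt a => PInt (f a)
  | PAdd t u => PAdd (pterm_map f t) (pterm_map f u)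
  | PMul t u => PMul (pterm_map f t) (pterm_map f u)
  end.

Fixpoint psen_map (A B : Type) (f : A -> B) (x : psen A) : psen B :=
  match x with
  | PLt t u => PLt (pterm_map f t) (pterm_map f u)
  | PNot x => PNot (psen_map f x)
  | PAnd x y => PAnd (psen_map f x) (psen_map f y)
  end.

Fixpoint pterm_val (S A : Type) (p : powerset_probability S)
  (v : S -> A -> Prop) (t : pterm A) : R :=
  match t with
  | PConst r => r
  | PInt a => p [set s | v s a]
  | PAdd t u => (pterm_val p v t + pterm_val p v u)%R
  | PMul t u => (pterm_val p v t * pterm_val p v u)%R
  end.

Fixpoint psat (S A : Type) (p : powerset_probability S)
  (v : S -> A -> Prop) (x : psen A) : Prop :=
  match x with
  | PLt t u => (pterm_val p v t < pterm_val p v u)%R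
  | PNot x => ~ psat p v x
  | PAnd x y => psat p v x /\ psat p v y
  end.

Let pterm_map_id (A : Type) (t : pterm A) : pterm_map id t = t.
Proof. by elim: t => //= t -> u ->. Qed.

Let psen_map_id (A : Type) (x : psen A) : psen_map id x = x.
Proof. by elim: x => //= [t u|x ->|x -> y ->] //; rewrite !pterm_map_id. Qed.

Let pterm_map_comp (A B C : Type) (g : B -> C) (f : A -> B) (t : pterm A) :
  pterm_map (fun a => g (f a)) t = pterm_map g (pterm_map f t).
Proof. by elim: t => //= t -> u ->. Qed.

Let psen_map_comp (A B C : Type) (g : B -> C) (f : A -> B) (x : psen A) :
  psen_map (fun a => g (f a)) x = psen_map g (psen_map f x).
Proof.
by elim: x => [t u|x IH|x IHx y IHy] /=;
  rewrite ?IH ?IHx ?IHy // (pterm_map_comp g f t) (pterm_map_comp g f u).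
Qed.

Let pterm_val_map (S A B : Type) (p : powerset_probability S) (f : A -> B)
    (v : S -> B -> Prop) (t : pterm A) :
  pterm_val p (fun s a => v s (f a)) t = pterm_val p v (pterm_map f t).
Proof. by elim: t => //= t -> u ->. Qed.

Let psat_map (S A B : Type) (p : powerset_probability S) (f : A -> B)
    (v : S -> B -> Prop) (x : psen A) :
  psat p (fun s a => v s (f a)) x <-> psat p v (psen_map f x).
Proof.
elim: x => /= [t u|x IH|x IHx y IHy]; last by rewrite IHx IHy.
- by rewrite (pterm_val_map p f v t) (pterm_val_map p f v u).
- by rewrite IH.
Qed.

Definition probabilistic_layer : top_layer :=
  @TopLayer one_category (fun _ => powerset_probability) (fun _ _ _ _ r => r)
    (fun _ _ _ => erefl) (fun _ _ _ _ _ _ _ => erefl)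
    (fun _ => psen) (fun _ _ A B _ f => psen_map f)
    (fun _ => psen_map_id) (fun _ _ _ A B C _ _ => @psen_map_comp A B C)
    (fun _ => psat) (fun _ _ S A B _ => @psat_map S A B).

End Probabilistic.

Section Hybrid.

Record hsign := HSign { Nom : Type; Lam : Type }.

Record hsign_hom (D E : hsign) := HSignHom {
  nom_map : Nom D -> Nom E;
  lam_map : Lam D -> Lam E }.

Definition hsign_category : category :=
  @Category hsign hsign_hom (fun D => HSignHom id id)
    (fun D E F g f => HSignHom (fun i => nom_map g (nom_map f i))
                               (fun l => lam_map g (lam_map f l)))
    (fun D E f => let: HSignHom _ _ := f in erefl)
    (fun D E f => let: HSignHom _ _ := f in erefl)
    (fun _ _ _ _ _ _ _ => erefl).

Record hstr (D : hsign) (S : Type) := HStr {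
  nomI : Nom D -> S;
  lamI : Lam D -> set (S * S) }.

Inductive hsen (D : hsign) (A : Type) : Type :=
| HNom of Nom D
| HBase of A
| HNot of hsen D A
| HAnd of hsen D A & hsen D A
| HAt of Nom D & hsen D A
| HDia of Lam D & hsen D A.

Definition hstr_map (D E : hsign) (S : Type) (d : hsign_hom D E)
  (r : hstr E S) : hstr D S :=
  @HStr D S (fun i => nomI r (nom_map d i)) (fun l => lamI r (lam_map d l)).

Fixpoint hsen_map (D E : hsign) (A B : Type) (d : hsign_hom D E) (f : A -> B)
  (x : hsen D A) : hsen E B :=
  match x with
  | HNom i => HNom B (nom_map d i)
  | HBase a => HBase E (f a)
  | HNot x => HNot (hsen_map d f x)
  | HAnd x y => HAnd (hsen_map d f x) (hsen_map d f y)
  | HAt i x => HAt (nom_map d i) (hsen_map d f x)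
  | HDia l x => HDia (lam_map d l) (hsen_map d f x)
  end.

Fixpoint hsat_at (D : hsign) (S A : Type) (r : hstr D S)
  (v : S -> A -> Prop) (w : S) (x : hsen D A) : Prop :=
  match x with
  | HNom i => nomI r i = w
  | HBase a => v w a
  | HNot x => ~ hsat_at r v w x
  | HAnd x y => hsat_at r v w x /\ hsat_at r v w y
  | HAt i x => hsat_at r v (nomI r i) x
  | HDia l x => exists w', lamI r l (w, w') /\ hsat_at r v w' x
  end.

Definition hsat (D : hsign) (S A : Type) (r : hstr D S)
  (v : S -> A -> Prop) (x : hsen D A) : Prop := forall w, hsat_at r v w x.

Let hstr_map_id (D : hsign_category) (S : Type) (r : hstr D S) :
  hstr_map (idm D) r = r.
Proof. by case: r. Qed.

Let hsen_map_id (D : hsign_category) (A : Type) (x : hsen D A) :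
  hsen_map (idm D) id x = x.
Proof. by elim: x => //= [x ->|x -> y ->|i x ->|l x ->]. Qed.

Let hsen_map_comp (D E F : hsign_category) (A B C : Type) (d' : hom E F)
    (d : hom D E) (g : B -> C) (f : A -> B) (x : hsen D A) :
  hsen_map (comp d' d) (fun a => g (f a)) x = hsen_map d' g (hsen_map d f x).
Proof. by elim: x => //= [x ->|x -> y ->|i x ->|l x ->]. Qed.

Let hsat_map (D E : hsign_category) (S A B : Type) (d : hom D E)
    (r : hstr E S) (f : A -> B) (v : S -> B -> Prop) (x : hsen D A) :
  hsat (hstr_map d r) (fun s a => v s (f a)) x <-> hsat r v (hsen_map d f x).
Proof.
suff satE w : hsat_at (hstr_map d r) (fun s a => v s (f a)) w x <->
              hsat_at r v w (hsen_map d f x) by split=> h w; apply/satE.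
elim: x w => /= [i|a|x IH|x IHx y IHy|i x IH|l x IH] w.
- by [].
- by [].
- by rewrite IH.
- by rewrite IHx IHy.
- exact: IH.
- by split=> -[w' [rw' xw']]; exists w'; split=> //; apply/IH.
Qed.

Definition hybrid_layer : top_layer :=
  @TopLayer hsign_category hstr (fun D E S d => @hstr_map D E S d)
    hstr_map_id (fun _ _ _ _ _ _ _ => erefl)
    hsen (fun D E A B d f => hsen_map d f)
    hsen_map_id hsen_map_comp hsat hsat_map.

End Hybrid.

Variant combination := Temporalisation | Probabilisation | Hybridisation.

Definition layer_of (R : realType) (C : combination) : top_layer :=
  match C with
  | Temporalisation => temporal_layer
  | Probabilisation => probabilistic_layer R
  | Hybridisation => hybrid_layer
  end.

Definition combine (R : realType) (C : combination) (I : institution) :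
  institution := lift (layer_of R C) I.

Definition combine_comorphism (R : realType) (C : combination)
  (I J : institution) (f : comorphism I J) :
  comorphism (combine R C I) (combine R C J) := lift_comorphism (layer_of R C) f.

(* Main.v *)
Require Import Defs.
From mathcomp Require Import all_boot boolp reals.

(* The lifted [beta] only touches the labelling [m], so a preimage of
   [(S, R, m)] is [(S, R, n)], where [n] picks, by the axiom of choice, a
   [beta]-preimage of [m s] for every [s]. *)
Lemma conservative_lift (K : top_layer) (I J : institution)
    (f : comorphism I J) :
  conservative f -> conservative (lift_comorphism K f).
Proof.
move=> hf x [S r m].
have [n nE] := choice (fun s => hf x.2 (m s)).
(* [r] can be reused because [lift_Phi] is the identity on top-level signatures, and [n] is
   admissible because labellings are arbitrary functions. *)
exists (@LiftModel K J (lift_Phi K f x) S r n) => /=.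
by congr LiftModel; apply: funext.
Qed.

(** The argument is uniform in the top layer: [combine_comorphism R C f] unfolds to the lift of [f]
    along [layer_of R C], so all three combinations are covered without a case split on [C]. *)
Theorem theorem4 (R : realType) (C : combination) (I J : institution)
  (f : comorphism I J) (hf : conservative f) :
  conservative (combine_comorphism R C f).
Proof. exact: conservative_lift. Qed.
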